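(* Let $G$ be a finite simple bipartite graph with bipartition $V_1=\{x_1,\dots,x_g\}$, $V_2=\{y_1,\dots,y_g\}$ such that $\{x_i,y_i\}$ is an edge of $G$ for every $i=1,\dots,g$. Let $\mathcal{D}$ be the directed graph with vertex set $V_1$ in which $(x_i,x_j)$ is an arrow if and only if $i\neq j$ and $\{x_i,y_j\}$ is an edge of $G$. If $G$ is sequentially Cohen–Macaulay, then $\mathcal{D}$ is acyclic, i.e., $\mathcal{D}$ has no oriented cycle.
   Context: $G$ is sequentially Cohen–Macaulay if $R/I(G)$ is sequentially Cohen–Macaulay, where $R=k[x_1,\dots,x_g,y_1,\dots,y_g]$ over a field $k$ and $I(G)$ is generated by the products $uv$ over edges $\{u,v\}$ of $G$. A graded module $M$ is sequentially Cohen–Macaulay if there is a finite filtration of graded submodules $0=M_0\subset M_1\subset\cdots\subset M_r=M$ with each $M_i/M_{i-1}$ Cohen–Macaulay and $\dim(M_1/M_0)<\cdots<\dim(M_r/M_{r-1})$. An oriented cycle of $\mathcal{D}$ is a cycle (of length at least $2$, e.g. two arrows $(x_i,x_j),(x_j,x_i)$) all of whose arrows point in the same direction around the cycle. *)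

(* Defs.v *)
From HB Require Import structures.
From mathcomp Require Import all_boot all_order all_algebra.
From mathcomp Require Import boolp.
From mathcomp Require Import mpoly.

Set Implicit Arguments.
Unset Strict Implicit.
Unset Printing Implicit Defensive.

Import GRing.Theory.
Local Open Scope ring_scope.
Local Open Scope quotient_scope.

Section Modules.
Variables (R : comNzRingType) (V : lmodType R).

Section Submodule.
Variable N : submodClosed V.

Record submodule := Submodule { submodule_val : V; _ : submodule_val \in N }.

HB.instance Definition _ := [isSub for submodule_val].
HB.instance Definition _ := [Choice of submodule by <:].
HB.instance Definition _ := [SubChoice_isSubLmodule of submodule by <:].
End Submodule.

Section QuotientModule.
Variable N : submodClosed V.

(* [submodClosed] does not inherit from [zmodClosed], which [Quotient.quot] needs;
   [quot_pred N] is [N] itself, with that structure. *)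
Definition quot_pred : V -> bool := fun x => x \in N.

Fact quot_pred_zmod_closed : zmod_closed quot_pred.
Proof.
exact: GRing.submod_closedB (GRing.subsemimod_closed_submod (GRing.subsemimodClosedP N)).
Qed.

HB.instance Definition _ := GRing.isZmodClosed.Build V quot_pred
  quot_pred_zmod_closed.

Definition quot_zmod : zmodClosed V := GRing.ZmodClosed.clone V quot_pred _.

Definition quot_module := Quotient.quot quot_zmod.

HB.instance Definition _ := GRing.Zmodule.on quot_module.

Definition quot_scale (a : R) (x : quot_module) : quot_module :=
  \pi_quot_module (a *: repr x).

Lemma pi_quot_eq (x y : V) :
  (\pi_quot_module x == \pi_quot_module y) = (x - y \in N).
Proof. by rewrite -Quotient.idealrBE. Qed.

Lemma pi_quotD (x y : V) :
  \pi_quot_module (x + y) = \pi_quot_module x + \pi_quot_module y.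
Proof. exact: raddfD. Qed.

Lemma quot_scale_pi a (x : V) :
  quot_scale a (\pi_quot_module x) = \pi_quot_module (a *: x).
Proof.
apply/eqP; rewrite pi_quot_eq -scalerBr; apply: rpredZ.
by rewrite -pi_quot_eq reprK.
Qed.

Fact quot_scalerA a b (x : quot_module) :
  quot_scale a (quot_scale b x) = quot_scale (a * b) x.
Proof. by rewrite -[x]reprK (quot_scale_pi b) 2!quot_scale_pi scalerA. Qed.

Fact quot_scale1r : left_id 1 quot_scale.
Proof. by move=> x; rewrite -[x]reprK quot_scale_pi scale1r. Qed.

Fact quot_scalerDr : right_distributive quot_scale +%R.
Proof.
move=> a x y; rewrite -[x]reprK -[y]reprK.
by rewrite -pi_quotD !quot_scale_pi -pi_quotD scalerDr.
Qed.

Fact quot_scalerDl x : {morph quot_scale^~ x : a b / a + b}.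
Proof.
by move=> a b; rewrite -[x]reprK !quot_scale_pi -pi_quotD scalerDl.
Qed.

HB.instance Definition _ := GRing.Zmodule_isLmodule.Build R quot_module
  quot_scalerA quot_scale1r quot_scalerDr quot_scalerDl.

Definition quot_proj (x : V) : quot_module := \pi_quot_module x.

Lemma quot_proj_is_linear : linear quot_proj.
Proof.
move=> a x y; rewrite /quot_proj pi_quotD; congr (_ + _).
by rewrite -quot_scale_pi.
Qed.

HB.instance Definition _ := GRing.isLinear.Build R V quot_module _ quot_proj
  quot_proj_is_linear.

Lemma quot_projP (x : V) : (quot_proj x == 0) = (x \in N).
Proof. by rewrite -[0](raddf0 quot_proj) pi_quot_eq subr0. Qed.

Lemma quot_proj_surj (x : quot_module) : exists y, x = quot_proj y.
Proof. by exists (repr x); rewrite /quot_proj reprK. Qed.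

End QuotientModule.
End Modules.

Section Subquotient.
Variables (R : comNzRingType) (V : lmodType R) (P N : submodClosed V).

Definition restr_pred : submodule P -> bool := fun x => val x \in N.

Fact restr_pred_submod_closed : subsemimod_closed restr_pred.
Proof.
have inE x : (x \in restr_pred) = (val x \in N) by [].
split=> [|a x]; first split=> [|x y]; rewrite !inE.
- by rewrite raddf0 rpred0.
- by rewrite raddfD; apply: rpredD.
- by rewrite linearZ; apply: rpredZ.
Qed.

HB.instance Definition _ := GRing.isSubSemiModClosed.Build R (submodule P)
  restr_pred restr_pred_submod_closed.

Definition restr : submodClosed (submodule P) :=
  GRing.SubmodClosed.clone R (submodule P) restr_pred _.

(* P / N; it is only used for N contained in P *)
Definition subquotient : lmodType R := quot_module restr.

End Subquotient.

Section Dimension.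
Variables (R : comNzRingType) (M : lmodType R).

Definition annihilates (r : R) : Prop := forall x : M, r *: x = 0.

(* P 0 < P 1 < ... < P d, a strict chain of primes containing Ann M *)
Definition prime_chain (d : nat) (P : nat -> prime_idealr R) : Prop :=
  (forall r, annihilates r -> r \in P 0%N) /\
  forall i, (i < d)%N ->
    {subset P i <= P i.+1} /\ exists2 r, r \in P i.+1 & r \notin P i.

(* dim M = dim R / Ann M; the zero module has no dimension *)
Definition krull_dim_is (d : nat) : Prop :=
  (exists P, prime_chain d P) /\
  (forall e P, prime_chain e P -> (e <= d)%N).

(* x lies in (s_0, ..., s_(i-1)) M *)
Definition in_ideal_mul (s : seq R) (i : nat) (x : M) : Prop :=
  exists c : nat -> M, x = \sum_(j < i) s`_j *: c j.

Definition regular_seq (s : seq R) : Prop :=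
  (forall i (x : M), (i < size s)%N ->
     in_ideal_mul s i (s`_i *: x) -> in_ideal_mul s i x) /\
  exists x : M, ~ in_ideal_mul s (size s) x.

(* the largest length of an M-regular sequence of elements of m *)
Definition depth_is (m : pred R) (d : nat) : Prop :=
  (exists2 s, all m s & regular_seq s /\ size s = d) /\
  (forall s, all m s -> regular_seq s -> (size s <= d)%N).

End Dimension.

Section Graded.
Variables (n : nat) (k : fieldType).
Local Notation R := {mpoly k[n]}.

Definition irrelevant_ideal : pred R := fun p => p@_(0%MM) == 0.

(* For a finitely generated graded M, the depth of M is its depth with respect
   to the irrelevant ideal. *)
Definition cohen_macaulay (M : lmodType R) : Prop :=
  exists2 d, krull_dim_is M d & depth_is M irrelevant_ideal d.

Record grading (M : lmodType R) := Grading {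
  gpart :> int -> M -> Prop;
  gpart0 : forall i, gpart i 0;
  gpartB : forall i x y, gpart i x -> gpart i y -> gpart i (x - y);
  gpartZ : forall d i p x, p \is d.-homog -> gpart i x ->
    gpart (d%:Z + i) (p *: x);
  gpart_sum : forall x, exists s : seq int, exists2 c : int -> M,
    forall i, gpart i (c i) & x = \sum_(i <- s) c i;
  gpart_direct : forall (s : seq int) (c : int -> M), uniq s ->
    (forall i, gpart i (c i)) -> \sum_(i <- s) c i = 0 ->
    forall i, i \in s -> c i = 0
}.

Definition graded_submodule (M : lmodType R) (gr : grading M)
    (N : submodClosed M) : Prop :=
  forall x, x \in N -> exists s : seq int, exists2 c : int -> M,
    forall i, gr i (c i) /\ c i \in N & x = \sum_(i <- s) c i.

Definition sequentially_CM (M : lmodType R) (gr : grading M) : Prop :=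
  exists (r : nat) (F : nat -> submodClosed M) (d : nat -> nat),
  [/\ forall x, (x \in F 0%N) = (x == 0),
      forall x, x \in F r,
      forall i, (i <= r)%N -> graded_submodule gr (F i),
      forall i, (i < r)%N ->
        [/\ {subset F i <= F i.+1},
            cohen_macaulay (subquotient (F i.+1) (F i))
          & krull_dim_is (subquotient (F i.+1) (F i)) (d i)]
    & forall i, (i.+1 < r)%N -> (d i < d i.+1)%N].

End Graded.

Section EdgeIdeal.
Variables (n : nat) (k : fieldType) (E : rel 'I_n).
Local Notation R := {mpoly k[n]}.

(* [R^o] is R as a module over itself, [R] alone being a k-module. *)
Definition edge_pred : R^o -> bool := fun p =>
  `[< exists c : 'I_n * 'I_n -> R,
        p = \sum_(e | E e.1 e.2) c e * ('X_(e.1) * 'X_(e.2)) >].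

Fact edge_pred_closed : subsemimod_closed edge_pred.
Proof.
split=> [|a p]; first split=> [|p q].
- apply/asboolP; exists (fun=> 0).
  by rewrite big1 // => e _; rewrite mul0r.
- move=> /asboolP[c ->] /asboolP[c' ->]; apply/asboolP.
  exists (fun e => c e + c' e); rewrite -big_split /=.
  by apply: eq_bigr => e _; rewrite mulrDl.
- move=> /asboolP[c ->]; apply/asboolP; exists (fun e => a * c e).
  rewrite [LHS]mulr_sumr; apply: eq_bigr => e _; exact: mulrA.
Qed.

HB.instance Definition _ := GRing.isSubSemiModClosed.Build R R^o edge_pred
  edge_pred_closed.

Definition edge_ideal : submodClosed R^o :=
  GRing.SubmodClosed.clone R R^o edge_pred _.

Definition edge_ring : lmodType R := quot_module edge_ideal.
Local Notation proj := (@quot_proj R R^o edge_ideal).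

Lemma edge_ideal_gen u v (a : R) : E u v -> a * ('X_u * 'X_v) \in edge_ideal.
Proof.
move=> Euv; apply/asboolP.
exists (fun e => if e == (u, v) then a else 0).
rewrite (bigD1 (u, v)) //= eqxx big1 ?addr0 // => e /andP[_ /negbTE ->].
by rewrite mul0r.
Qed.

Lemma edge_ideal_homog d (p : R) :
  (p : R^o) \in edge_ideal -> (pihomog mdeg d p : R^o) \in edge_ideal.
Proof.
move=> /asboolP[c ->]; rewrite [pihomog _ _ _]raddf_sum.
apply: (@rpred_sum R^o) => -[u v] /= Euv.
rewrite (pihomog_partitionE (leqnn (mmeasure mdeg (c (u, v))))).
rewrite mulr_suml [pihomog _ _ _]raddf_sum.
apply: (@rpred_sum R^o) => i _ /=.
set q := pihomog mdeg i _.
have hq : q * ('X_u * 'X_v) \is (i + 2).-homog.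
  apply: dhomogM; first exact: pihomogP.
  by apply: (@dhomogM _ _ _ 1 _ 1); rewrite dhomogX /= mdeg1.
have [<-|ne] := eqVneq (i + 2)%N d.
  by rewrite (pihomog_dE hq) edge_ideal_gen.
by rewrite (pihomog_ne0 ne hq) rpred0.
Qed.

Definition edge_ring_part (i : int) (x : edge_ring) : Prop :=
  match i with
  | Posz d => exists2 p : R, p \is d.-homog & x = proj p
  | Negz _ => x = 0
  end.

Fact edge_ring_part0 i : edge_ring_part i 0.
Proof.
case: i => //= d; exists 0; first by rewrite dhomog0.
by rewrite raddf0.
Qed.

Fact edge_ring_partB i x y :
  edge_ring_part i x -> edge_ring_part i y -> edge_ring_part i (x - y).
Proof.
case: i => [d [p hp ->] [q hq ->]|d -> ->] /=; last by rewrite subr0.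
by exists (p - q); [rewrite rpredB | rewrite raddfB].
Qed.

Fact edge_ring_partZ d i (p : R) x :
  p \is d.-homog -> edge_ring_part i x -> edge_ring_part (d%:Z + i) (p *: x).
Proof.
case: i => [e hp [q hq ->]|e hp ->]; last by rewrite scaler0; apply: edge_ring_part0.
by exists (p * q); [exact: dhomogM | rewrite -linearZ].
Qed.

Fact edge_ring_part_sum x : exists s : seq int, exists2 c : int -> edge_ring,
  forall i, edge_ring_part i (c i) & x = \sum_(i <- s) c i.
Proof.
have [p ->] := quot_proj_surj x.
exists (map Posz (iota 0 (mmeasure mdeg (p : R)))).
exists (fun i => if i is Posz d then proj (pihomog mdeg d p) else 0).
  by case=> [d|d] //=; exists (pihomog mdeg d p) => //; apply: pihomogP.
rewrite big_map {1}(pihomog_partitionE (leqnn (mmeasure mdeg (p : R)))).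
by rewrite raddf_sum -(big_mkord xpredT (fun d => proj (pihomog mdeg d p)))
           /index_iota subn0.
Qed.

Fact edge_ring_part_direct (s : seq int) (c : int -> edge_ring) : uniq s ->
  (forall i, edge_ring_part i (c i)) -> \sum_(i <- s) c i = 0 ->
  forall i, i \in s -> c i = 0.
Proof.
move=> us hc s0 [d|d] si; last exact: (hc (Negz d)).
have hex i : exists p : R, c i = proj p /\
    if i is Posz e then p \is e.-homog else p = 0.
  case: i => e; first by have [p hp ->] := hc (Posz e); exists p.
  by exists 0; split=> //; rewrite (hc (Negz e)) raddf0.
have [f hf] := choice hex.
have : (\sum_(i <- s) f i : R^o) \in edge_ideal.
  rewrite -quot_projP raddf_sum; apply/eqP; apply: etrans s0.
  by apply: eq_bigr => i _; rewrite (hf i).1.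
move=> /(edge_ideal_homog d); rewrite [pihomog _ _ _]raddf_sum.
rewrite (bigD1_seq (Posz d)) //= [X in _ + X]big1 => [|[e|e] ne]; first last.
- by rewrite (hf (Negz e)).2 raddf0.
- by apply: pihomog_ne0 (hf (Posz e)).2; apply: contra_neq ne => ->.
rewrite addr0 (pihomog_dE (hf (Posz d)).2) -quot_projP => /eqP <-.
exact: (hf (Posz d)).1.
Qed.

Definition edge_ring_grading : grading edge_ring :=
  Grading edge_ring_part0 edge_ring_partB edge_ring_partZ edge_ring_part_sum
    edge_ring_part_direct.

End EdgeIdeal.

Definition graph_sequentially_CM (n : nat) (k : fieldType) (E : rel 'I_n) : Prop :=
  sequentially_CM (edge_ring_grading k E).

Section BipartiteGraph.
Variable g : nat.

(* The 2g vertices: x_i is the i-th one and y_i the (g + i)-th one. *)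
Definition vx (i : 'I_g) : 'I_(g + g) := lshift g i.
Definition vy (i : 'I_g) : 'I_(g + g) := rshift g i.

Definition simple_graph (n : nat) (E : rel 'I_n) : Prop :=
  ssrbool.symmetric E /\ irreflexive E.

Definition xy_bipartite (E : rel 'I_(g + g)) : Prop :=
  forall i j, ~~ E (vx i) (vx j) /\ ~~ E (vy i) (vy j).

Definition assoc_digraph (E : rel 'I_(g + g)) : rel 'I_g :=
  fun i j => (i != j) && E (vx i) (vy j).

End BipartiteGraph.

(* [ucycle D c]: the vertices of c are distinct and there is an arrow from each
   of them to the next one, and from the last one to the first. *)
Definition acyclic_digraph (T : finType) (D : rel T) : Prop :=
  ~ exists2 c : seq T, (2 <= size c)%N & ucycle D c.

(* Main.v *)
(* Let I be the edge ideal and R/J the last factor of a filtration witnessing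
   sequential Cohen-Macaulayness; it is Cohen-Macaulay of dimension d. Koszul
   cohomology of R/J with respect to all variables vanishes in degrees < d, and
   dropping variables one at a time, by graded Nakayama, it vanishes in degree i
   with respect to T whenever i + #|~: T| < d. In degree 0 this says that a
   squarefree monomial outside J has a squarefree multiple outside J of degree
   at least d; with the perfect matching this gives d = g, and x_i y_j is in J
   whenever D has a path from i to j. On the other hand J is contained in every
   prime over I generated by g variables.
   If D has a cycle, it has a strong component K with at least 2 elements.
   Choosing x_i or y_i for each i outside K gives a monomial u of degree
   g - #|K| such that both u * x_K and u * y_K are supported on independent
   sets. The vertices on the x-side and on the y-side of K are disconnected in
   the link of u, which contradicts vanishing in degree 1. *)
From HB Require Import structures.
Require Import Defs.
From mathcomp Require Import all_boot all_order all_algebra.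
From mathcomp Require Import mpoly.
From mathcomp Require Import boolp ring zify.

Set Implicit Arguments.
Unset Strict Implicit.
Unset Printing Implicit Defensive.

Import GRing.Theory.
Local Open Scope ring_scope.

(** * Koszul cochains modulo an ideal of a commutative ring *)

Section Koszul.
Variable R : comNzRingType.
Implicit Types (l : seq R) (c b : seq bool -> R) (s : seq bool) (N : R -> Prop).

Definition ideal N : Prop :=
  [/\ N 0, forall x y, N x -> N y -> N (x + y) & forall a x, N x -> N (a * x)].

Lemma idealB N x y : ideal N -> N x -> N y -> N (x - y).
Proof. by case=> _ ND NM Nx Ny; rewrite -[- y]mulN1r; apply: ND (Nx) (NM _ _ Ny). Qed.

Lemma idealBC N x y : ideal N -> N (x - y) -> N (y - x).
Proof. by case=> _ _ NM; move=> /(NM (- 1)); rewrite mulN1r opprB. Qed.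

(* A cochain of the Koszul complex on l assigns a scalar to each subset of the
   positions of l, given by its characteristic sequence. *)
Fixpoint koszul_d l c s : R :=
  match l, s with
  | x :: l', true :: s' =>
      x * c (false :: s') - koszul_d l' (fun t => c (true :: t)) s'
  | _ :: l', false :: s' => koszul_d l' (fun t => c (false :: t)) s'
  | _, _ => 0
  end.

(* Contraction against the k-th position. *)
Fixpoint contract k c s : R :=
  match k, s with
  | 0, false :: s' => c (true :: s')
  | k'.+1, true :: s' => - contract k' (fun t => c (true :: t)) s'
  | k'.+1, false :: s' => contract k' (fun t => c (false :: t)) s'
  | _, _ => 0
  end.

Lemma koszul_d_lin l a c c' s :
  koszul_d l (fun t => a * c t + c' t) s = a * koszul_d l c s + koszul_d l c' s.
Proof.
elim: l c c' s => [|x l IH] c c' [|[] s] /=; rewrite ?mulr0 ?addr0 //.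
by rewrite (IH (fun t => c (true :: t)) (fun t => c' (true :: t))); ring.
Qed.

Lemma contract_lin k a c c' s :
  contract k (fun t => a * c t + c' t) s = a * contract k c s + contract k c' s.
Proof.
elim: k c c' s => [|k IH] c c' [|[] s] /=; rewrite ?mulr0 ?addr0 //.
by rewrite (IH (fun t => c (true :: t)) (fun t => c' (true :: t))); ring.
Qed.

Lemma koszul_d_ext l c c' s : c =1 c' -> koszul_d l c s = koszul_d l c' s.
Proof.
elim: l c c' s => [|x l IH] c c' [|[] s] //= e.
  by rewrite e (IH _ (fun t => c' (true :: t))).
exact: IH.
Qed.

Lemma contract_ext k c c' s : c =1 c' -> contract k c s = contract k c' s.
Proof.
elim: k c c' s => [|k IH] c c' [|[] s] //= e.
  by rewrite (IH _ (fun t => c' (true :: t))).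
exact: IH.
Qed.

Lemma koszul_d0 l s : koszul_d l (fun=> 0) s = 0.
Proof. by elim: l s => [|x l IH] [|[] s] //=; rewrite IH subr0 mulr0. Qed.

Lemma koszul_dZ l a c s : koszul_d l (fun t => a * c t) s = a * koszul_d l c s.
Proof.
rewrite -[RHS]addr0 -[in RHS](koszul_d0 l s) -koszul_d_lin.
by apply: koszul_d_ext => t; rewrite addr0.
Qed.

Lemma koszul_dB l c c' s :
  koszul_d l (fun t => c t - c' t) s = koszul_d l c s - koszul_d l c' s.
Proof.
rewrite addrC -mulN1r -koszul_d_lin.
by apply: koszul_d_ext => t; rewrite mulN1r addrC.
Qed.

Lemma koszul_dN l c s : koszul_d l (fun t => - c t) s = - koszul_d l c s.
Proof. by rewrite -mulN1r -koszul_dZ; apply: koszul_d_ext => t; rewrite mulN1r. Qed.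

Lemma contractB k c c' s :
  contract k (fun t => c t - c' t) s = contract k c s - contract k c' s.
Proof.
rewrite addrC -mulN1r -contract_lin.
by apply: contract_ext => t; rewrite mulN1r addrC.
Qed.

Lemma contract0 k s : contract k (fun=> 0) s = 0.
Proof. by elim: k s => [|k IH] [|[] s] //=; rewrite IH oppr0. Qed.

Lemma contractZ k a c s : contract k (fun t => a * c t) s = a * contract k c s.
Proof.
rewrite -[RHS]addr0 -[in RHS](contract0 k s) -contract_lin.
by apply: contract_ext => t; rewrite addr0.
Qed.

Lemma koszul_d_koszul_d l c s : koszul_d l (koszul_d l c) s = 0.
Proof.
elim: l c s => [|x l IH] c [|[] s] //=.
by rewrite koszul_dB IH subr0 koszul_dZ subrr.
Qed.

Lemma koszul_d_weight0 l c s : count id s = 0%N -> koszul_d l c s = 0.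
Proof.
elim: s l c => [|[] s IH] [|x l] c //=.
by rewrite add0n => /IH.
Qed.

(** The homotopy formula: contraction is a null-homotopy of multiplication by the generator at
    position k. *)
Lemma koszul_d_contract l k c s : (k < size l)%N -> size s = size l ->
  koszul_d l (contract k c) s + contract k (koszul_d l c) s = l`_k * c s.
Proof.
elim: l k c s => [|x l IH] [|k] c [|b s] //=; rewrite ?ltnS => kl [ss].
  by case: b => /=; rewrite ?koszul_d0 //; ring.
case: b => /=.
  rewrite koszul_dN contractB contractZ.
  by rewrite -(IH k (fun t => c (true :: t)) s kl ss); ring.
exact: IH.
Qed.

Definition wt l i s := (size s == size l) && (count id s == i).

Lemma koszul_d_mem N l i c : ideal N -> (forall s, wt l i s -> N (c s)) ->
  forall s, wt l i.+1 s -> N (koszul_d l c s).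
Proof.
move=> hN; have [N0 ND NM] := hN.
elim: l i c => [|x l IH] i c hc [|b s] //= /andP[]; rewrite eqSS => ss.
case: b => /= hs.
  apply: idealB => //; first by apply: NM; apply: hc; rewrite /wt /= eqSS ss.
  case: i hc hs => [|i] hc hs.
    by rewrite koszul_d_weight0 //; lia.
  apply: IH (_ : wt l i.+1 s) => [t /andP[ts tc]|]; last by rewrite /wt ss.
  by apply: hc; rewrite /wt /= eqSS ts.
apply: (IH i) => [t /andP[ts tc]|]; last by rewrite /wt ss.
by apply: hc; rewrite /wt /= eqSS ts.
Qed.

Lemma contract_mem N l i k c : ideal N -> (forall s, wt l i.+1 s -> N (c s)) ->
  forall s, wt l i s -> N (contract k c s).
Proof.
move=> hN; have [N0 ND NM] := hN.
elim: k l i c => [|k IH] l i c hc [|b s] //= /andP[ss hs].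
  case: b ss hs => //= ss hs; apply: hc.
  by rewrite /wt /= ss.
case: l ss hc => [//|x l] /=; rewrite eqSS => ss hc.
case: b hs => /= hs.
  rewrite -mulN1r; apply: NM; case: i hs hc => // i hs hc.
  apply: (IH l i) => [t /andP[ts tc]|]; last by rewrite /wt ss.
  by apply: hc; rewrite /wt /= eqSS ts.
apply: (IH l i) => [t /andP[ts tc]|]; last by rewrite /wt ss.
by apply: hc; rewrite /wt /= eqSS ts.
Qed.

(** Cochains are total functions, of which degree i sees only the values at sequences of weight i.
    In degree 0 the differential is zero, so a coboundary is a cochain with values in N. *)
Definition cocycle N l i c := forall s, wt l i.+1 s -> N (koszul_d l c s).
Definition coboundary N l i c :=
  exists b, forall s, wt l i s -> N (c s - koszul_d l b s).

Lemma coboundary_mul_gen N l i c f : ideal N -> cocycle N l i c ->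
  f \in l -> coboundary N l i (fun s => f * c s).
Proof.
move=> hN hc /(nthP 0)[k kl <-]; exists (contract k c) => s sw.
have /andP[/eqP ss _] := sw.
rewrite -(koszul_d_contract c kl ss) addrAC subrr add0r.
exact: (contract_mem k (c := koszul_d l c) hN hc sw).
Qed.

Lemma coboundaryD N l i c c' : ideal N -> coboundary N l i c ->
  coboundary N l i c' -> coboundary N l i (fun s => c s + c' s).
Proof.
move=> [_ ND _] [b hb] [b' hb']; exists (fun s => b s - - b' s) => s sw.
rewrite koszul_dB koszul_dN opprK opprD addrACA.
by apply: ND; [apply: hb | apply: hb'].
Qed.

Lemma coboundaryZ N l i c a : ideal N -> coboundary N l i c ->
  coboundary N l i (fun s => a * c s).
Proof.
move=> [_ _ NM] [b hb]; exists (fun s => a * b s) => s sw.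
by rewrite koszul_dZ -mulrBr; apply: NM; apply: hb.
Qed.

Lemma coboundary_ext N l i c c' : c =1 c' -> coboundary N l i c ->
  coboundary N l i c'.
Proof. by move=> e [b hb]; exists b => s sw; rewrite -e; apply: hb. Qed.

Lemma coboundary0 N l i : ideal N -> coboundary N l i (fun=> 0).
Proof. by case=> N0 _ _; exists (fun=> 0) => s _; rewrite koszul_d0 subr0. Qed.

(** Uniform in N, so that it applies to every ideal in the chain built from a regular sequence. *)
Definition kills l f := forall N i c, ideal N -> cocycle N l i c ->
  coboundary N l i (fun s => f * c s).

Definition kexact N l i := forall c, cocycle N l i c -> coboundary N l i c.

(* The N j play the role of the ideals J + (f_0, ..., f_(j-1)) for a regular
   sequence f on the quotient by J. *)
Lemma regular_kexact l (N : nat -> R -> Prop) (f : nat -> R) d :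
  (forall j, ideal (N j)) ->
  (forall j, (j < d)%N -> kills l (f j)) ->
  (forall j p, (j < d)%N -> N j (f j * p) -> N j p) ->
  (forall j p, N j.+1 p <-> exists q, N j (p - f j * q)) ->
  forall i j, (i + j < d)%N -> kexact (N j) l i.
Proof.
move=> hN hk hreg hS; elim=> [|i IH] j lt c hc.
  rewrite add0n in lt.
  have [b hb] := hk j lt _ _ _ (hN j) hc.
  exists b => s sw; apply: (hreg j) => //; rewrite mulrBr.
  have /andP[_ /eqP s0] := sw.
  by have := hb _ sw; rewrite !koszul_d_weight0 // mulr0.
have jd : (j < d)%N by apply: leq_ltn_trans lt; rewrite leq_addl.
have [N0 ND NM] := hN j.
(* Modulo [N j], f_j c = d b. So b is a cocycle modulo [N j.+1], and by induction b = d e + f_j q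
   modulo [N j]. Applying d gives f_j c = f_j d q, and f_j is cancelled by regularity. *)
have [b hb] := hk j jd _ _ _ (hN j) hc.
have bc : cocycle (N j.+1) l i b.
  move=> s sw; apply/hS; exists (c s); apply: idealBC => //.
  exact: hb.
have [|e he] := IH j.+1 _ b bc; first by rewrite addnS -addSn.
have hq s : exists q, wt l i s -> N j (b s - koszul_d l e s - f j * q).
  have [sw|_] := boolP (wt l i s); last by exists 0.
  by have /hS[q hq] := he s sw; exists q.
have {hq} [q hq] := choice hq.
exists q => s sw; apply: (hreg j) => //.
have -> : f j * (c s - koszul_d l q s) = (f j * c s - koszul_d l b s) +
    koszul_d l (fun t => b t - koszul_d l e t - f j * q t) s.
  rewrite (koszul_dB _ (fun t => b t - koszul_d l e t)) koszul_dB
    koszul_d_koszul_d koszul_dZ.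
  ring.
by apply: ND; [apply: hb | apply: koszul_d_mem hq _ sw].
Qed.

Lemma weight0E s : count id s = 0%N -> s = nseq (size s) false.
Proof.
by elim: s => [|[] s IH] //=; rewrite add0n => /IH {1}->.
Qed.

Lemma koszul_d_weight1 l c s : wt l 1 s ->
  koszul_d l c s = l`_(index true s) * c (nseq (size l) false).
Proof.
elim: l c s => [|x l IH] c [|b s] //= /andP[]; rewrite eqSS => ss.
case: b => /= [|s1].
  rewrite add1n eqSS => /eqP s0; rewrite koszul_d_weight0 // subr0.
  have ss' : size s = size l := eqP ss.
  by rewrite {1}(weight0E s0) ss'.
by rewrite IH // /wt ss.
Qed.

Lemma koszul_d_weight2 l (h : nat -> R) s : wt l 2 s ->
  exists j k, [/\ (j < size l)%N, (k < size l)%N &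
    koszul_d l (fun t => h (index true t)) s = l`_j * h k - l`_k * h j].
Proof.
elim: l h s => [|x l IH] h [|b s] //= /andP[]; rewrite eqSS => ss.
case: b => /= [|s2].
  rewrite add1n eqSS => s1; have sw : wt l 1 s by rewrite /wt ss.
  exists 0%N, (index true s).+1; split=> //=; last first.
    by rewrite (koszul_d_weight1 (fun=> h 0%N) sw).
  have ss' : size s = size l := eqP ss.
  rewrite ltnS -ss' index_mem -has_pred1 has_count.
  by rewrite (@eq_count _ _ id) ?(eqP s1) // => -[].
have [|j [k [jl kl e]]] := IH (fun m => h m.+1) s; first by rewrite /wt ss.
by exists j.+1, k.+1.
Qed.

Definition one_hot l j := nseq j false ++ true :: nseq (size l - j.+1) false.

Lemma one_hot_index l j : index true (one_hot l j) = j.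
Proof. by rewrite index_cat mem_nseq andbF size_nseq /= addn0. Qed.

Lemma one_hot_wt l j : (j < size l)%N -> wt l 1 (one_hot l j).
Proof.
move=> jl; rewrite /wt size_cat /= !size_nseq count_cat /= !count_nseq /=.
by rewrite !mul0n addnS -addSn subnKC // !eqxx.
Qed.

End Koszul.

(** * Graded Koszul cohomology with respect to sets of variables *)

Section Polynomial.
Variables (n : nat) (k : fieldType).
Local Notation R := {mpoly k[n]}.
Implicit Types (N : R -> Prop) (p : R).
Local Notation ph := (pihomog mdeg).

(** Every monomial of f is divisible by a variable, and variables in l kill the cohomology by
    contraction. *)
Lemma kills_irrelevant (l : seq R) f : (forall i, 'X_i \in l) ->
  f \in @irrelevant_ideal n k -> kills l f.
Proof.
move=> lX /eqP f0 N i c hN hc; rewrite (mpolyE f) big_seq.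
apply: (big_ind (fun q => coboundary N l i (fun s => q * c s))).
- apply: (@coboundary_ext _ _ _ _ (fun=> 0)) => [s|]; first by rewrite mul0r.
  exact: coboundary0.
- move=> p q hp hq; apply: coboundary_ext (coboundaryD hN hp hq) => s.
  by rewrite mulrDl.
move=> m mf; have [j mj] : exists j, m j != 0%N.
  apply: contrapT => h; move: mf; rewrite mcoeff_msupp.
  suff -> : m = 0%MM by rewrite f0 eqxx.
  apply/mnmP => j; rewrite mnm0E; apply/eqP.
  by have [//|mj] := boolP (m j == 0%N); case: h; exists j.
have hX := coboundary_mul_gen hN hc (lX j).
have := coboundaryZ (f@_m *: 'X_[m - U_(j)]) hN hX.
apply: coboundary_ext => s /=.
by rewrite -!scalerAl mulrA -mpolyXD submK // lep1mP.
Qed.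

Lemma pihomogXM d i p :
  ph d ('X_i * p) = 'X_i * (if d is e.+1 then ph e p else 0).
Proof.
rewrite (mpolyE p) mulr_sumr [LHS]raddf_sum /=.
under eq_bigr => m _ do rewrite -scalerAr linearZ /= -mpolyXD pihomogX /= mdegD mdeg1.
case: d => [|e]; first by rewrite mulr0 big1 // => m _; rewrite scaler0.
rewrite raddf_sum mulr_sumr; apply: eq_bigr => m _.
rewrite /= linearZ /= pihomogX -scalerAr add1n eqSS.
by case: ifP; rewrite ?mulr0 // mpolyXD.
Qed.

Definition Xs (l : seq 'I_n) : seq R := [seq 'X_i | i <- l].

Lemma pihomog_koszul_d d l (c : seq bool -> R) s :
  ph d (koszul_d (Xs l) c s) =
    koszul_d (Xs l) (fun t => if d is e.+1 then ph e (c t) else 0) s.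
Proof.
elim: l c s => [|x l IH] c [|[] s] /=; rewrite ?raddf0 //.
by rewrite pihomogB pihomogXM IH; case: d {IH}.
Qed.

Definition homogeneous N := forall e p, N p -> N (ph e p).

(** Exactness is asked only for cochains whose values share one degree e, which makes induction on e
    possible. *)
Definition hexact N l i := forall e c, (forall s, ph e (c s) = c s) ->
  cocycle N (Xs l) i c -> coboundary N (Xs l) i c.

(** Put c on the subsets containing x and 0 elsewhere. This is a cocycle on [x :: l]; the two halves
    of a primitive are a and b. *)
Lemma hexact_surj N x l i e c : ideal N -> hexact N (x :: l) i.+1 ->
  (forall s, ph e (c s) = c s) -> cocycle N (Xs l) i c ->
  exists a b, cocycle N (Xs l) i a /\
    forall s, wt (Xs l) i s -> N (c s - ('X_x * a s - koszul_d (Xs l) b s)).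
Proof.
move=> hN hex he hc; have [N0 ND NM] := hN.
pose C s := if s is true :: t then c t else 0.
have hC : cocycle N (Xs (x :: l)) i.+1 C.
  move=> [|[] s] //= /andP[]; rewrite eqSS => ss /= sw; last by rewrite koszul_d0.
  by rewrite mulr0 sub0r -mulN1r; apply: NM; apply: hc; rewrite /wt ss.
have [|B hB] := hex e C _ hC; first by move=> [|[] s] /=; rewrite ?raddf0.
exists (fun s => B (false :: s)), (fun s => B (true :: s)); split.
  move=> s /andP[ss sw].
  have := hB (false :: s); rewrite /wt /= eqSS ss sw => /(_ isT).
  by rewrite sub0r => /(NM (-1)); rewrite mulN1r opprK.
by move=> s /andP[ss sw]; have := hB (true :: s); apply; rewrite /wt /= eqSS ss.
Qed.

(* By [hexact_surj], x acts surjectively on the cohomology of l; hence the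
   latter vanishes by graded Nakayama, an induction on the degree. *)
Lemma hexact_behead N x l i : ideal N -> homogeneous N ->
  hexact N (x :: l) i.+1 -> hexact N l i.
Proof.
move=> hN hh hex; have [N0 ND NM] := hN; elim=> [|e IH] c he hc.
  have [a [b [_ hab]]] := hexact_surj hN hex he hc.
  (* Neither x a nor d b has a part of degree 0, so c itself has values in N. *)
  exists (fun=> 0) => s /hab /(hh 0%N).
  rewrite koszul_d0 pihomogB pihomogB pihomogXM pihomog_koszul_d.
  by rewrite koszul_d0 mulr0 he !subr0.
have [a [b [ha hab]]] := hexact_surj hN hex he hc.
have [||q hq] := IH (fun t => ph e (a t)).
- by move=> s; rewrite pihomog_id.
- by move=> s sw; rewrite -(pihomog_koszul_d e.+1); apply: hh; apply: ha.
(* Take the part of degree e + 1 of c = x a - d b and replace the degree e part of a by d q. *)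
exists (fun t => 'X_x * q t - ph e (b t)) => s sw.
have := ND _ _ (hh e.+1 _ (hab s sw)) (NM 'X_x _ (hq _ sw)).
rewrite pihomogB pihomogB pihomogXM pihomog_koszul_d he koszul_dB koszul_dZ.
congr N; ring.
Qed.

Lemma hexact_drop N l l' i : ideal N -> homogeneous N ->
  hexact N (l ++ l') (size l + i) -> hexact N l' i.
Proof.
move=> hN hh; elim: l => [|x l IH] //= h.
by apply: IH; apply: hexact_behead h.
Qed.

(** With T full this is the Koszul form of depth at least d; each omitted variable costs one
    degree. *)
Definition deep N d := forall (T : {set 'I_n}) i, (#|~: T| + i < d)%N ->
  hexact N (enum T) i.

Lemma regular_deep (N : nat -> R -> Prop) (f : nat -> R) d :
  (forall j, ideal (N j)) -> homogeneous (N 0%N) ->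
  (forall j, (j < d)%N -> f j \in @irrelevant_ideal n k) ->
  (forall j p, (j < d)%N -> N j (f j * p) -> N j p) ->
  (forall j p, N j.+1 p <-> exists q, N j (p - f j * q)) ->
  deep (N 0%N) d.
Proof.
move=> hN hh hf hreg hS T i lt.
(* The variables outside T are put in front; the whole list then contains every variable, so the
   regular sequence kills its cohomology. *)
apply: (@hexact_drop _ (enum (~: T))) => //.
rewrite -cardE => e c _; apply: (regular_kexact hN _ hreg hS).
  move=> j /hf; apply: kills_irrelevant => v.
  by apply: map_f; rewrite mem_cat !mem_enum inE orNb.
by rewrite addn0.
Qed.

(** The constant cochain p is a 0-cocycle on T, and 0-coboundaries have values in N. *)
Lemma deep_H0 N d (T : {set 'I_n}) e p : ideal N -> deep N d ->
  (#|~: T| < d)%N -> ph e p = p -> (forall t, t \in T -> N ('X_t * p)) -> N p.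
Proof.
move=> hN hd lt hp hT; have [N0 ND NM] := hN.
have [||b hb] := hd T 0%N _ e (fun=> p) (fun=> hp); first by rewrite addn0.
  move=> s sw; rewrite koszul_d_weight1 //.
  have [sT|sT] := ltnP (index true s) (size (enum T)); last first.
    by rewrite nth_default ?mul0r // size_map.
  have t0 : 'I_n by case: (enum T) sT.
  by rewrite (nth_map t0) //; apply: hT; rewrite -mem_enum mem_nth.
have := hb (nseq (size (Xs (enum T))) false).
rewrite /wt size_nseq count_nseq eqxx => /(_ isT).
by rewrite koszul_d_weight0 ?count_nseq ?subr0.
Qed.

(** The family m is a 1-cochain and the condition on pairs makes it a cocycle; p is the value of a
    primitive at the empty subset. *)
Lemma deep_H1 N d (T : {set 'I_n}) e (m : 'I_n -> R) : ideal N -> deep N d ->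
  (#|~: T|.+1 < d)%N -> (forall v, ph e (m v) = m v) ->
  (forall v w, v \in T -> w \in T -> N ('X_v * m w - 'X_w * m v)) ->
  exists p, forall v, v \in T -> N (m v - 'X_v * p).
Proof.
move=> hN hd lt hm hT.
pose h j := nth 0 [seq m v | v <- enum T] j.
have [|s||b hb] := hd T 1%N _ e (fun s => h (index true s)).
- by rewrite addn1.
- rewrite /h; have [sT|sT] := ltnP (index true s) (size (enum T)); last first.
    by rewrite nth_default ?size_map // raddf0.
  have t0 : 'I_n by case: (enum T) sT.
  by rewrite (nth_map t0).
- move=> s /(koszul_d_weight2 h)[i [j []]]; rewrite size_map => il jl ->.
  have t0 : 'I_n by case: (enum T) il.
  by rewrite /h !(nth_map t0) //; apply: hT; rewrite -mem_enum mem_nth.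
exists (b (nseq (size (Xs (enum T))) false)) => v vT.
have vl : (index v (enum T) < size (Xs (enum T)))%N.
  by rewrite size_map index_mem mem_enum.
have vl' : (index v (enum T) < size (enum T))%N by rewrite index_mem mem_enum.
have sw := one_hot_wt vl.
have := hb _ sw; rewrite koszul_d_weight1 // one_hot_index /h !(nth_map v) //.
by rewrite nth_index ?mem_enum.
Qed.

End Polynomial.

(** * Primes generated by variables, and squarefree monomials *)

Section MonomialPrimes.
Variables (n : nat) (k : fieldType).
Local Notation R := {mpoly k[n]}.
Local Notation ph := (pihomog mdeg).
Implicit Types (C S : {set 'I_n}) (p : R) (J : R -> Prop).

(** The kernel of this endomorphism is the ideal generated by the variables in C; it is prime
    because the polynomial ring is a domain. *)
Definition kill C p : R := p \mPo [tuple if i \in C then 0 else 'X_i | i < n].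

HB.instance Definition _ C :=
  GRing.RMorphism.copy (kill C)
    (comp_mpoly [tuple if i \in C then 0 else 'X_i | i < n]).

Lemma killX C i : kill C 'X_i = if i \in C then 0 else 'X_i.
Proof. by rewrite /kill comp_mpolyXU -tnth_nth tnth_mktuple. Qed.

Lemma kill_id C i : i \in C -> kill C 'X_i = 0.
Proof. by rewrite killX => ->. Qed.

Lemma killZ C a p : kill C (a *: p) = a *: kill C p.
Proof. exact: comp_mpolyZ. Qed.

Lemma kill_sub C C' p : C \subset C' -> kill C' (kill C p) = kill C' p.
Proof.
move=> sC; elim/mpolyind: p => [|a m p _ _ IH]; first by rewrite !rmorph0.
rewrite !rmorphD /= IH !killZ; congr (a *: _ + _).
rewrite mpolyXE_id !rmorph_prod; apply: eq_bigr => i _ /=.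
rewrite !rmorphXn /= killX; congr (_ ^+ _).
by case: ifP => // /(subsetP sC) iC; rewrite rmorph0 kill_id.
Qed.

Lemma kill_sub0 C C' p : C \subset C' -> kill C p = 0 -> kill C' p = 0.
Proof. by move=> sC p0; rewrite -(kill_sub p sC) p0 rmorph0. Qed.

Definition monomial_prime C : pred R := fun p => kill C p == 0.

Lemma monomial_primeE C p : (p \in monomial_prime C) = (kill C p == 0).
Proof. by []. Qed.

Fact monomial_prime_idealr C : idealr_closed (monomial_prime C).
Proof.
split=> [||a p q]; rewrite !monomial_primeE ?rmorph0 ?rmorph1 ?oner_eq0 //.
by move=> /eqP p0 /eqP q0; rewrite rmorphD rmorphM /= p0 q0 mulr0 addr0.
Qed.

Fact monomial_prime_prime C : prime_idealr_closed (monomial_prime C).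
Proof. by move=> p q; rewrite !monomial_primeE rmorphM mulf_eq0. Qed.

HB.instance Definition _ C :=
  isIdealr.Build R (monomial_prime C) (monomial_prime_idealr C).
HB.instance Definition _ C :=
  isPrimeIdealrClosed.Build R (monomial_prime C) (@monomial_prime_prime C).

Lemma mpolyX_neq0 (i : 'I_n) : 'X_i != 0 :> R.
Proof.
apply/eqP => /(congr1 (mcoeff U_(i))); rewrite mcoeffXU eqxx mcoeff0.
by move/eqP; rewrite oner_eq0.
Qed.

(** The chain adjoins the variables outside C one at a time. *)
Lemma monomial_prime_chain (M : lmodType R) C :
  (forall r, annihilates M r -> kill C r = 0) ->
  exists P, prime_chain M #|~: C| P.
Proof.
move=> hM; pose L := enum (~: C).
pose D i := C :|: [set x in take i L].
exists (fun i => monomial_prime (D i)); split=> [r /hM r0|i iL].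
  by rewrite monomial_primeE (@kill_sub0 C) // subsetUl.
have sL : size L = #|~: C| by rewrite -cardE.
rewrite -sL in iL.
have x0 : 'I_n by move: iL; case: (L).
split=> [p|].
  rewrite !monomial_primeE => /eqP /kill_sub0 -> //.
  apply: setUS; apply/subsetP => x; rewrite !inE (take_nth x0) //.
  by rewrite mem_rcons inE => ->; rewrite orbT.
exists 'X_(nth x0 L i); rewrite monomial_primeE killX.
  by rewrite !inE (take_nth x0) // mem_rcons inE eqxx orbT eqxx.
have /negbTE -> : nth x0 L i \notin D i; last exact: mpolyX_neq0.
have := mem_nth x0 iL; rewrite mem_enum !inE => /negbTE -> /=.
have : uniq (take i.+1 L) by rewrite take_uniq ?enum_uniq.
by rewrite (take_nth x0) // rcons_uniq => /andP[].
Qed.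

Definition Xset S : R := \prod_(i in S) 'X_i.

Lemma XsetU1 i S : i \notin S -> Xset (i |: S) = 'X_i * Xset S.
Proof. exact: big_setU1. Qed.

Lemma Xset_homog S : ph #|S| (Xset S) = Xset S.
Proof.
apply: pihomog_dE; rewrite /Xset -sum1_card.
apply: (big_ind2 (fun p d => p \is d.-homog)); first exact: dhomog1.
  by move=> p d q e; apply: dhomogM.
by move=> i _; rewrite dhomogX /= mdeg1.
Qed.

Lemma kill_Xset C S : [disjoint S & C] -> kill C (Xset S) != 0.
Proof.
move=> /disjointFr dSC; rewrite rmorph_prod; apply/prodf_neq0 => i iS /=.
by rewrite killX dSC // mpolyX_neq0.
Qed.

Lemma ideal_Xset J S u v : ideal J -> u \in S -> v \in S -> u != v ->
  J ('X_u * 'X_v) -> J (Xset S).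
Proof.
move=> [_ _ JM] uS vS uv Juv; rewrite /Xset (bigD1 u) //= (bigD1 v) /=; last first.
  by rewrite vS eq_sym.
by rewrite mulrA mulrC; apply: JM.
Qed.

(** Take S' maximal with its monomial outside J. Every variable outside S' multiplies that monomial
    into J, so [deep_H0] would put it in J if S' had fewer than d elements. *)
Lemma deep_extend J d S : ideal J -> deep J d -> ~ J (Xset S) ->
  exists S', [/\ S \subset S', ~ J (Xset S') & (d <= #|S'|)%N].
Proof.
move=> hJ hd hS; pose Q S := `[< ~ J (Xset S) >].
have [|S' /maxsetP[/asboolP QS' hmax] sS] := @maxset_exists _ Q S.
  exact/asboolP.
exists S'; split=> //; rewrite leqNgt; apply/negP => lt; apply: QS'.
apply: (deep_H0 (T := ~: S') hJ hd) (Xset_homog S') _; first by rewrite setCK.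
move=> t; rewrite inE => tS; rewrite -XsetU1 //.
apply: contrapT => nJ; have := hmax (t |: S') _ (subsetUr _ _).
move=> /(_ (asboolT nJ)) e; move: tS; rewrite -e; by rewrite setU11.
Qed.

End MonomialPrimes.

(** * Regular sequences on a cyclic module *)

Section CyclicModule.
Variables (n : nat) (k : fieldType).
Local Notation R := {mpoly k[n]}.

Lemma cyclic_deep (M : lmodType R) (z : M) (s : seq R) :
  (forall x : M, exists p : R, x = p *: z) ->
  homogeneous (fun p : R => p *: z = 0) ->
  all (@irrelevant_ideal n k) s -> regular_seq M s ->
  deep (fun p : R => p *: z = 0) (size s).
Proof.
move=> hz hh hs [hreg _].
(* For M = R / Ann z this is Ann z + (s_0, ..., s_(j-1)). *)
pose N j (p : R) := in_ideal_mul s j (p *: z).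
have N0 : N 0%N = (fun p => p *: z = 0).
  apply: funext => p; apply/propext; rewrite /N /in_ideal_mul; split.
    by case=> c ->; rewrite big_ord0.
  by move=> ->; exists (fun=> 0); rewrite big_ord0.
rewrite -N0; apply: (@regular_deep _ _ N (fun j => s`_j)).
- move=> j; split.
  + by exists (fun=> 0); rewrite scale0r big1 // => i _; rewrite scaler0.
  + move=> p q [c hc] [c' hc']; exists (fun i => c i + c' i).
    by rewrite scalerDl hc hc' -big_split; apply: eq_bigr => i _; rewrite /= scalerDr.
  + move=> a p [c hc]; exists (fun i => a *: c i).
    rewrite -scalerA hc scaler_sumr; apply: eq_bigr => i _.
    by rewrite !scalerA mulrC.
- by rewrite N0.
- by move=> j js; apply: (allP hs); apply: mem_nth.
- by move=> j p js; rewrite /N -scalerA; apply: hreg.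
move=> j p; split=> [[c hc]|[q [c hc]]].
  have [q hq] := hz (c j); exists q; exists c.
  by rewrite scalerBl hc big_ord_recr /= hq scalerA addrK.
exists (fun i => if i == j then q *: z else c i); rewrite big_ord_recr /= eqxx.
rewrite -[LHS](subrK ((s`_j * q) *: z)) -scalerBl hc scalerA; congr (_ + _).
by apply: eq_bigr => i _; rewrite ltn_eqF.
Qed.

End CyclicModule.

(** * The last factor of the filtration *)

Section SequentiallyCM.
Variables (n : nat) (k : fieldType) (E : rel 'I_n).
Local Notation R := {mpoly k[n]}.
Local Notation ph := (pihomog mdeg).
Local Notation pr := (@quot_proj R R^o (edge_ideal k E)).

Lemma subquotient_scale_eq0 (V : lmodType R) (P N : submodClosed V) x
    (hx : x \in P) r :
  (r *: quot_proj (restr P N) (Submodule hx) == 0) = (r *: x \in N).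
Proof. by rewrite -linearZ quot_projP. Qed.

Lemma quot_proj_scale1 p : pr p = p *: pr 1.
Proof. by rewrite -linearZ; congr (pr _); rewrite -[LHS]mulr1. Qed.

(** Homogeneous lifts of the components sum to p up to the edge ideal, which is itself homogeneous;
    so the degree e part of p maps to a multiple of the component of degree e. *)
Lemma graded_homogeneous (N : submodClosed (edge_ring k E)) :
  graded_submodule (edge_ring_grading k E) N -> homogeneous (fun p => pr p \in N).
Proof.
move=> hN e p /hN[s [c hc hp]].
have hex i : exists q : R, c i = pr q /\
    if i is Posz d then q \is d.-homog else q = 0.
  have := (hc i).1; case: i => d /=; first by case=> q hq ->; exists q.
  by move=> ->; exists 0; rewrite raddf0.
have [f hf] := choice hex.
have : (p - \sum_(i <- s) f i : R^o) \in edge_ideal k E.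
  rewrite -quot_projP raddfB raddf_sum subr_eq0; apply/eqP.
  apply: etrans hp _.
  by apply: eq_bigr => i _; rewrite (hf i).1.
move=> /(edge_ideal_homog e); rewrite pihomogB -quot_projP raddfB subr_eq0.
move=> /eqP ->; rewrite [pihomog _ _ _]raddf_sum raddf_sum.
apply: rpred_sum => i _ /=; have [ci fi] := hf i.
case: i ci fi => d ci fi; last by rewrite fi !raddf0 rpred0.
have [de|ne] := eqVneq d e.
  by rewrite -de pihomog_dE // -ci; apply: (hc _).2.
by rewrite (pihomog_ne0 ne fi) raddf0 rpred0.
Qed.

Definition vertex_cover (C : {set 'I_n}) : Prop :=
  forall u v, E u v -> (u \in C) || (v \in C).

Lemma edge_ideal_kill C (p : R) : vertex_cover C -> pr p = 0 -> kill C p = 0.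
Proof.
move=> hC /eqP; rewrite quot_projP => /asboolP[c ->].
rewrite rmorph_sum big1 // => -[u v] /= Euv; rewrite !rmorphM /= !killX.
by have /orP[->|->] := hC _ _ Euv; rewrite ?mul0r ?mulr0.
Qed.

(* J / I(G) is the next to last term of the filtration. A cover C with
   complement of size at least d gives a prime of dimension at least d, so only
   the last factor R / J can be supported there. *)
Lemma sequentially_CM_top : graph_sequentially_CM k E ->
  exists (J : R -> Prop) d, [/\ ideal J, ~ J 1, deep J d,
    forall u v, E u v -> J ('X_u * 'X_v)
  & forall C, vertex_cover C -> (#|~: C| <= d)%N /\
      (#|~: C| = d -> forall p, J p -> kill C p = 0)].
Proof.
move=> [r [F [dm [F0 Fr hgr hstep hmono]]]].
pose J i (p : R) : Prop := pr p \in F i.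
have hJ i : ideal (J i).
  rewrite /J; split=> [|p q hp hq|a p hp]; first by rewrite raddf0 rpred0.
    by rewrite raddfD; apply: rpredD.
  by rewrite -[a * p]/(a *: (p : R^o)) linearZ; apply: rpredZ.
have Jkill C p : vertex_cover C -> J 0%N p -> kill C p = 0.
  by rewrite /J F0 => hC /eqP; apply: edge_ideal_kill.
case: r Fr hgr hstep hmono => [|r] Fr hgr hstep hmono.
  (* A filtration of length 0 would put 1 in the edge ideal, which lies in the prime generated by
     all variables. *)
  have hT : vertex_cover [set: 'I_n] by move=> u v; rewrite inE.
  have := Jkill _ 1 hT (Fr _); rewrite rmorph1 => /eqP.
  by rewrite oner_eq0.
have [sF [d' hkd' [[s hs [hsreg hsz]] _]] hkd] := hstep r (ltnSn r).
have d'E : d' = dm r.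
  have [[P hP] hPmax] := hkd; have [[P' hP'] hPmax'] := hkd'.
  by apply/eqP; rewrite eqn_leq (hPmax _ _ hP') (hPmax' _ _ hP).
(* The class z of 1 generates the last factor, which is thus R / J with J = Ann z. *)
pose M := subquotient (F r.+1) (F r).
pose z : M := quot_proj (restr (F r.+1) (F r)) (Submodule (Fr (pr 1))).
have zE : (fun p : R => p *: z = 0) = J r.
  apply: funext => p; apply/propext; rewrite /J quot_proj_scale1.
  rewrite -(subquotient_scale_eq0 (F r) (Fr (pr 1))).
  exact: (rwP eqP).
have zgen (x : M) : exists p : R, x = p *: z.
  have [[y hy] ->] := quot_proj_surj x.
  have [p yp] := quot_proj_surj y; exists p.
  rewrite -linearZ; congr quot_proj; apply: val_inj => /=.
  by rewrite yp; apply: quot_proj_scale1.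
exists (J r), (dm r); split=> //.
- rewrite -zE => z0; have [[P [hP _]] _] := hkd.
  have : 1 \in P 0%N.
    by apply: hP => x; have [p ->] := zgen x; rewrite scalerA mulrC -scalerA z0 scaler0.
  by rewrite idealr1.
- rewrite -d'E -hsz -zE; apply: cyclic_deep => //.
  by rewrite zE; apply: graded_homogeneous; apply: hgr.
- move=> u v Euv; have sub i : (i <= r)%N -> J i ('X_u * 'X_v).
    elim: i => [|i IH] ir; last first.
      by have [sub _ _] := hstep i (leqW ir); apply: sub; apply: IH; apply: ltnW.
    by rewrite /J F0 quot_projP -[X in X \in _]mul1r edge_ideal_gen.
  exact: sub.
move=> C hC.
have dm_le i j : (i <= j)%N -> (j <= r)%N -> (dm i <= dm j)%N.
  elim: j => [|j IH]; first by rewrite leqn0 => /eqP ->.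
  rewrite leq_eqVlt => /orP[/eqP -> //|ij jr].
  by apply: leq_trans (IH ij (ltnW jr)) (ltnW (hmono j _)).
(* At the first term leaving the prime of C, pick f outside it. If a annihilates that factor, then a
   f lies in the previous term, hence in the prime, and so does a. The factor therefore has
   dimension at least #|~: C|. *)
pose bad i := `[< exists p, J i p /\ kill C p <> 0 >].
have hbad : exists i, bad i.
  exists r.+1; apply/asboolP; exists 1; split; first exact: Fr.
  by rewrite rmorph1; apply/eqP; rewrite oner_eq0.
have [[|i]] := ex_minnP hbad.
  by move=> /asboolP[p [/(Jkill _ _ hC)]].
move=> /asboolP[f [Jf kf]] hmin.
have ir : (i <= r)%N.
  rewrite -ltnS; apply: hmin; apply/asboolP; exists 1; split; first exact: Fr.
  by rewrite rmorph1; apply/eqP; rewrite oner_eq0.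
have Ji p : J i p -> kill C p = 0.
  move=> Jp; apply: contrapT => kp.
  suff /hmin : bad i by rewrite ltnn.
  by apply/asboolP; exists p.
have [_ _ [_ hmax]] := hstep i ir.
have hCi : (#|~: C| <= dm i)%N.
  have [|P hP] := @monomial_prime_chain _ _ (subquotient (F i.+1) (F i)) C.
    move=> a ha; have /eqP := ha (quot_proj (restr (F i.+1) (F i)) (Submodule Jf)).
    rewrite subquotient_scale_eq0 -linearZ => /(Ji (a * f))/eqP.
    by rewrite rmorphM mulf_eq0 => /orP[/eqP //|/eqP].
  exact: hmax hP.
split; first by apply: leq_trans hCi (dm_le _ _ _ _).
(* An earlier factor would have dimension strictly below that of the last one, which is #|~: C|
   here. *)
move=> hCr; have [-> //|lt] := eqVneq r i.
have ltir : (i < r)%N by rewrite ltn_neqAle eq_sym lt.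
have := leq_trans (hmono i _) (dm_le i.+1 r ltir (leqnn _)).
by rewrite ltnS ltir -hCr ltnNge hCi => /(_ isT).
Qed.

End SequentiallyCM.

(** * Independent sets, the perfect matching and reachability in the digraph *)

Section BipartiteGraph.
Variables (g : nat) (G : rel 'I_(g + g)).
Hypothesis Gsimple : simple_graph G.
Hypothesis Gbip : xy_bipartite G.
Hypothesis Gxy : forall i, G (vx i) (vy i).
Local Notation D := (assoc_digraph G).
Implicit Types (T : {set 'I_g}) (S : {set 'I_(g + g)}).

Lemma vx_inj : injective (@vx g). Proof. exact: lshift_inj. Qed.
Lemma vy_inj : injective (@vy g). Proof. exact: rshift_inj. Qed.

Lemma edge_connect i j : G (vx i) (vy j) -> connect D i j.
Proof.
have [-> //|ij Gij] := eqVneq i j; apply: connect1.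
by rewrite /assoc_digraph ij.
Qed.

(** For T closed under the arrows of D this is an independent set of g vertices, and its complement
    is a cover by g vertices. *)
Definition facet T : {set 'I_(g + g)} :=
  [set (if i \in T then vx i else vy i) | i : 'I_g].

Lemma facet_vx T i : (vx i \in facet T) = (i \in T).
Proof.
apply/imsetP/idP => [[j _]|iT]; last by exists i; rewrite ?iT.
case: ifP => [jT /vx_inj -> //|_ /eqP]; by rewrite eq_lrshift.
Qed.

Lemma facet_vy T i : (vy i \in facet T) = (i \notin T).
Proof.
apply/imsetP/idP => [[j _]|iT]; last by exists i; rewrite ?(negbTE iT).
case: ifP => [jT /eqP|jT /vy_inj ->]; by [rewrite eq_rlshift | rewrite jT].
Qed.

Lemma card_facet T : #|facet T| = g.
Proof.
rewrite card_imset ?card_ord // => i j.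
case: ifP; case: ifP => _ _; [exact: vx_inj| | |exact: vy_inj] => /eqP.
  by rewrite eq_lrshift.
by rewrite eq_rlshift.
Qed.

Lemma facet_cover T :
  (forall i j, G (vx i) (vy j) -> i \in T -> j \in T) ->
  vertex_cover G (~: facet T).
Proof.
move=> hT u v; rewrite !inE -negb_and.
have [i ->|i ->] := split_ordP u; have [j ->|j ->] := split_ordP v.
- by have [/negbTE] := Gbip i j; rewrite /vx => ->.
- rewrite -/(vx i) -/(vy j) facet_vx facet_vy => /hT h.
  by apply/andP => -[/h ->].
- rewrite -/(vy i) -/(vx j) facet_vx facet_vy => Gij.
  by apply/andP => -[iT /(hT j i)]; rewrite (negbTE iT) Gsimple.1 => /(_ Gij).
- by have [_ /negbTE] := Gbip i j; rewrite /vy => ->.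
Qed.

Definition pair_index (v : 'I_(g + g)) : 'I_g :=
  match split v with inl i => i | inr i => i end.

Lemma pair_index_vx i : pair_index (vx i) = i.
Proof. by rewrite /pair_index (unsplitK (inl i)). Qed.

Lemma pair_index_vy i : pair_index (vy i) = i.
Proof. by rewrite /pair_index (unsplitK (inr i)). Qed.

Definition independent S := forall u v, G u v -> u \in S -> v \in S -> False.

(** An independent set meets each matching edge at most once. *)
Lemma pair_index_inj S : independent S -> {in S &, injective pair_index}.
Proof.
move=> hS u v; have [i ->|i ->] := split_ordP u; have [j ->|j ->] := split_ordP v;
  rewrite -?/(vx _) -?/(vy _) ?pair_index_vx ?pair_index_vy => uS + e;
  rewrite -e // => vS.
  by case: (hS _ _ (Gxy i)).
by case: (hS _ _ (Gxy i)).
Qed.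

Lemma independent_card S : independent S -> (#|S| <= g)%N.
Proof.
move=> hS; rewrite -(card_in_imset (pair_index_inj hS)).
by rewrite -[leqRHS]card_ord max_card.
Qed.

Lemma independent_full S : independent S -> (g <= #|S|)%N ->
  forall i, (vx i \in S) || (vy i \in S).
Proof.
move=> hS; rewrite -(card_in_imset (pair_index_inj hS)) => hg i.
have : i \in pair_index @: S.
  suff -> : pair_index @: S = setT by rewrite inE.
  by apply/eqP; rewrite eqEcard subsetT cardsT card_ord.
case/imsetP => v; have [j ->|j ->] := split_ordP v;
  by rewrite -?/(vx _) -?/(vy _) ?pair_index_vx ?pair_index_vy => vS ->; rewrite vS ?orbT.
Qed.

(** Along an arrow from i to l, x_i in S excludes y_l; as S meets every matching edge, x_l is in S.
    At the end of the path x_j excludes y_j. *)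
Lemma full_connect S i j : independent S -> (g <= #|S|)%N ->
  vx i \in S -> connect D i j -> vy j \notin S.
Proof.
move=> hS hg iS /connectP[p]; elim: p i iS => [|l p IH] i iS /=.
  by move=> _ ->; apply/negP; apply: hS (Gxy i) iS.
case/andP=> /andP[_ Gil]; apply: IH.
have /orP[//|lS] := independent_full hS hg l.
by case: (hS _ _ Gil).
Qed.

Section Deep.
Variables (k : fieldType) (J : {mpoly k[g + g]} -> Prop) (d : nat).
Hypotheses (Jideal : ideal J) (Jdeep : deep J d).
Hypothesis JG : forall u v, G u v -> J ('X_u * 'X_v).

Lemma Xset_independent S : ~ J (Xset k S) -> independent S.
Proof.
move=> nJ u v Guv uS vS; apply: nJ; apply: ideal_Xset (JG Guv) => //.
by apply: contraTneq Guv => ->; rewrite Gsimple.2.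
Qed.

Lemma deep_le : ~ J 1 -> (d <= g)%N.
Proof.
move=> J1; have [|S [_ nJ dS]] := deep_extend (S := set0) Jideal Jdeep.
  by rewrite /Xset big_set0.
by apply: leq_trans dS _; apply/independent_card/Xset_independent.
Qed.

(** Otherwise S would extend to an independent set of g vertices containing x_i and y_j, against
    [full_connect]. *)
Lemma connect_Xset S i j : d = g -> connect D i j -> vx i \in S -> vy j \in S ->
  J (Xset k S).
Proof.
move=> dg cij iS jS; apply: contrapT => nJ.
have [S' [/subsetP sS nJ' dS]] := deep_extend Jideal Jdeep nJ.
rewrite dg in dS; have hS := Xset_independent nJ'.
by have := full_connect hS dS (sS _ iS) cij; rewrite sS.
Qed.

End Deep.

(* If a and b lie in one strong component K of D, the facets of T1 and T2
   differ exactly by exchanging the x_i with the y_i for all i in K. The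
   1-cocycle with value X_v u on the x-side and 0 on the y-side of K would be a
   coboundary, so that u lies in the sum of the two facet primes, although its
   variables belong to both facets. *)
Lemma strong_component_trivial k a b : graph_sequentially_CM k G ->
  connect D a b -> connect D b a -> a = b.
Proof.
move=> /sequentially_CM_top[J [d [hJ J1 hdeep JG hC]]] cab cba.
apply/eqP; apply: contraT => ab.
have hcov T : (forall i j, G (vx i) (vy j) -> i \in T -> j \in T) ->
    (g <= d)%N /\ (g = d -> forall p, J p -> kill (~: facet T) p = 0).
  by move=> /facet_cover/hC; rewrite setCK card_facet.
have dg : d = g.
  have [|gd _] := hcov setT; first by move=> i j; rewrite !inE.
  by apply/eqP; rewrite eqn_leq gd (deep_le hJ hdeep JG).
(* T2 consists of the vertices that do not reach a, and T1 adds to it the strong component K of a;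
   both are closed under arrows. *)
pose T1 := [set i | connect D i a ==> connect D a i].
pose T2 := [set i | ~~ connect D i a].
have [|_ kill1] := hcov T1.
  move=> i j /edge_connect cij; rewrite !inE => /implyP hi; apply/implyP => ja.
  exact: connect_trans (hi (connect_trans cij ja)) cij.
have [|_ kill2] := hcov T2.
  move=> i j /edge_connect cij; rewrite !inE; apply: contra.
  exact: connect_trans.
have {}kill1 := kill1 (esym dg); have {}kill2 := kill2 (esym dg).
pose F := facet T1 :&: facet T2; pose u := Xset k F.
have aT1 : a \in T1 by rewrite inE connect0.
have aT2 : a \notin T2 by rewrite inE connect0.
(* F misses x_a and x_b, which are distinct members of the first facet. This gives the strict bound
   that vanishing in degree 1 requires. *)
have cF : (#|F|.+2 <= g)%N.
  rewrite -[leqRHS](card_facet T1) (cardsD1 (vx a) (facet T1)) facet_vx aT1.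
  rewrite (cardsD1 (vx b) (_ :\ _)) !inE facet_vx inE cba cab.
  rewrite (inj_eq vx_inj) eq_sym ab /= !add1n !ltnS.
  apply: subset_leq_card; apply/subsetP => v /setIP[v1 v2]; rewrite !inE v1.
  by apply/and3P; split=> //; apply: contraTneq v2 => ->;
    rewrite facet_vx inE ?connect0 ?cba.
pose m v := if v \in facet T1 then 'X_v * u else 0.
have hm v : pihomog mdeg #|F|.+1 (m v) = m v.
  by rewrite /m; case: ifP => _; rewrite ?raddf0 // pihomogXM Xset_homog.
(* Here v = x_i with i in K. If w = y_j with j in K, a path from i to j puts the product in J;
   otherwise the matching partner of w lies in F. *)
have mixed v w : v \in facet T1 -> v \notin F -> w \notin facet T1 ->
    J ('X_w * ('X_v * u)).
  move=> v1 vF w1; rewrite -XsetU1 // -XsetU1; last first.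
    rewrite !inE negb_or negb_and w1 andbT.
    by apply: contraNneq w1 => ->.
  have wS : w \in w |: (v |: F) by rewrite setU11.
  have sF x : x \in F -> x \in w |: (v |: F) by move=> xF; rewrite 2!in_setU xF !orbT.
  have vS : v \in w |: (v |: F) by rewrite !inE eqxx orbT.
  move: {sF}(_ |: _) wS vS (sF) => S wS vS sF.
  move: v1 vF; rewrite inE => v1; rewrite v1 /= => v2.
  have [i vi /andP[cia cai]] : exists2 i, v = vx i & connect D i a && connect D a i.
    have [i vi|i vi] := split_ordP v; move: v1 v2; rewrite vi.
      rewrite -/(vx i) !facet_vx !inE negbK => /implyP h cia.
      by exists i; rewrite // cia h.
    by rewrite -/(vy i) !facet_vy !inE negbK => /[swap] /negbTE ->.
  rewrite vi in vS; have [j wj|j wj] := split_ordP w; move: w1; rewrite wj in wS *.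
    rewrite -/(vx j) facet_vx inE => jT1.
    apply: (connect_Xset hJ hdeep JG dg (connect0 _ j) wS).
    apply: sF; rewrite inE !facet_vy !inE jT1 negbK.
    by move: jT1; rewrite negb_imply => /andP[].
  rewrite -/(vy j) facet_vy negbK inE => /implyP jT1.
  have [cja|cja] := boolP (connect D j a).
    apply: (connect_Xset hJ hdeep JG dg _ vS wS).
    exact: connect_trans cia (jT1 cja).
  apply: (connect_Xset hJ hdeep JG dg (connect0 _ j) _ wS).
  by apply: sF; rewrite inE !facet_vx !inE (negbTE cja).
have [J0 JD JM] := hJ.
have [||p hp] := deep_H1 (T := ~: F) hJ hdeep _ hm; first by rewrite setCK dg.
  move=> v w; rewrite !in_setC => vF wF; rewrite /m.
  case: ifPn => w1; case: ifPn => v1.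
  - by rewrite mulrCA subrr.
  - by rewrite mulr0 subr0; apply: mixed.
  - by rewrite mulr0 sub0r -mulN1r; apply: JM; apply: mixed.
  - by rewrite !mulr0 subr0.
have sub T : F \subset facet T -> ~: facet T \subset ~: F by rewrite setCS.
(* Cancelling x_a in the relation at x_a gives p = u modulo the first facet prime; the relation at
   y_a gives p = 0 modulo the second. *)
have e1 : kill (~: facet T1) u = kill (~: facet T1) p.
  have := hp (vx a); rewrite in_setC inE !facet_vx (negbTE aT2) andbF => /(_ isT).
  move=> /kill1; rewrite /m facet_vx aT1 -mulrBr rmorphM rmorphB /= killX.
  rewrite in_setC facet_vx aT1 /= => /eqP; rewrite mulf_eq0.
  by rewrite (negbTE (mpolyX_neq0 _ _)) subr_eq0 => /eqP.
have e2 : kill (~: facet T2) p = 0.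
  have := hp (vy a); rewrite in_setC inE !facet_vy aT1 /= => /(_ isT).
  move=> /kill2; rewrite /m facet_vy aT1 sub0r rmorphN rmorphM /= killX.
  rewrite in_setC facet_vy aT2 /= => /eqP; rewrite oppr_eq0 mulf_eq0.
  by rewrite (negbTE (mpolyX_neq0 _ _)) => /eqP.
have : kill (~: F) u != 0 by apply: kill_Xset; rewrite disjoints_subset setCK.
rewrite -(kill_sub u (sub T1 (subsetIl _ _))) e1 kill_sub ?sub ?subsetIl //.
by rewrite (kill_sub0 (sub T2 (subsetIr _ _)) e2) eqxx.
Qed.

End BipartiteGraph.

(* Acyclicity of the digraph *)
Local Close Scope ring_scope.

Theorem theorem4p4 (k : fieldType) (g : nat) (G : rel 'I_(g + g)) :
  simple_graph G ->
  xy_bipartite G ->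
  (forall i : 'I_g, G (vx i) (vy i)) ->
  graph_sequentially_CM k G ->
  acyclic_digraph (assoc_digraph G).
Proof.
move=> Gs Gb Gxy hG [[|a [|b c]] // _ /andP[Dc /= /andP[abc _]]].
have aS : a \in [:: a, b & c] by rewrite inE eqxx.
have bS : b \in [:: a, b & c] by rewrite !inE eqxx orbT.
have cab := connect_cycle Dc aS bS; have cba := connect_cycle Dc bS aS.
move: abc; rewrite (strong_component_trivial Gs Gb Gxy hG cab cba).
by rewrite inE eqxx.
Qed.
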